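(* Consider classifiers that do not use the protected attribute. For $\mathrm{Dis}\in\{\mathrm{DD},\mathrm{DO},\mathrm{PD}\}$ suppose that $\eta^Y(X)$ and $w_{\mathrm{Dis}}(X)$ have probability density functions, the boundary sets $\{x:\eta^Y(x)=\frac12+\frac t2w_{\mathrm{Dis}}(x)\}$, $t\in\mathbb R$, being of $\mathbb P_X$-measure zero. For $\delta\ge0$ consider the fair cost-sensitive risks $$R^{\mathrm{FCSC}}_{X,t_{X,\mathrm{DD}}(\delta)}(f)=\sum_{a,y\in\{0,1\}}\Big(\frac12+\frac{(2a-1)(1-2y)\,t_{X,\mathrm{DD}}(\delta)}{2p_a}\Big)\mathbb P(\widehat Y_f=1-y,Y=y,A=a),$$ $$R^{\mathrm{FCSC}}_{X,t_{X,\mathrm{DO}}(\delta)}(f)=\sum_{a,y\in\{0,1\}}\Big(\frac12+\frac{(1-2a)\,y\,t_{X,\mathrm{DO}}(\delta)}{2p_{a,y}}\Big)\mathbb P(\widehat Y_f=1-y,Y=y,A=a),$$ $$R^{\mathrm{FCSC}}_{X,t_{X,\mathrm{PD}}(\delta)}(f)=\sum_{a,y\in\{0,1\}}\Big(\frac12+\frac{(2a-1)(1-y)\,t_{X,\mathrm{PD}}(\delta)}{2p_{a,y}}\Big)\mathbb P(\widehat Y_f=1-y,Y=y,A=a),$$ and for each $\mathrm{Dis}\in\{\mathrm{DD},\mathrm{DO},\mathrm{PD}\}$ let $f^{\mathrm{FCSC}}_{X,t_{X,\mathrm{Dis}}(\delta)}\in\operatorname{argmin}_f R^{\mathrm{FCSC}}_{X,t_{X,\mathrm{Dis}}(\delta)}(f)$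 over classifiers $f:\mathcal X\to[0,1]$. Then, for any $\delta\ge0$, $f^{\mathrm{FCSC}}_{X,t_{X,\mathrm{DD}}(\delta)}$, $f^{\mathrm{FCSC}}_{X,t_{X,\mathrm{DO}}(\delta)}$ and $f^{\mathrm{FCSC}}_{X,t_{X,\mathrm{PD}}(\delta)}$ are $\delta$-fair Bayes-optimal classifiers for $\mathbb P$ under demographic parity, equality of opportunity, and predictive equality, respectively.
   Context: Let $(X,A,Y)\sim\mathbb P$ be a random triple with values in $\mathcal X\times\{0,1\}\times\{0,1\}$, with $p_a=\mathbb P(A=a)$, $p_{a,y}=\mathbb P(A=a,Y=y)>0$, $\eta^Y(x)=\mathbb P(Y=1\mid X=x)$, $\eta^A(x)=\mathbb P(A=1\mid X=x)$, $\eta^Y_{A=a}(x)=\mathbb P(Y=1\mid A=a,X=x)$; $\mathbb P_X$ is the law of $X$. $I(\cdot)$ is the indicator function. The protected attribute is not available for prediction: a classifier is a measurable $f:\mathcal X\to[0,1]$ with prediction $\widehat Y_f\mid X\sim\mathrm{Bernoulli}(f(X))$, conditionally independent of $(A,Y)$ given $X$; $R(f)=\mathbb P(Y\ne\widehat Y_f)$. The disparity measures are $\mathrm{DD}(f)=\mathbb P(\widehat Y_f=1\mid A=1)-\mathbb P(\widehat Y_f=1\mid A=0)$ (demographic parity), $\mathrm{DO}(f)=\mathbb P(\widehat Y_f=1\mid A=1,Y=1)-\mathbb P(\widehat Y_f=1\mid A=0,Y=1)$ (equality of opportunity), $\mathrm{PD}(f)=\mathbb P(\widehat Y_f=1\mid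 A=1,Y=0)-\mathbb P(\widehat Y_f=1\mid A=0,Y=0)$ (predictive equality). A $\delta$-fair Bayes-optimal classifier under $\mathrm{Dis}$ is any element of $\operatorname{argmin}_{f:\mathcal X\to[0,1]}\{R(f):|\mathrm{Dis}(f)|\le\delta\}$. Weighting functions: $w_{\mathrm{DD}}(x)=\frac{\eta^A(x)}{p_1}-\frac{1-\eta^A(x)}{p_0}$, $w_{\mathrm{DO}}(x)=\frac{\eta^Y_{A=1}(x)\eta^A(x)}{p_{1,1}}-\frac{\eta^Y_{A=0}(x)(1-\eta^A(x))}{p_{0,1}}$, $w_{\mathrm{PD}}(x)=\frac{(1-\eta^Y_{A=1}(x))\eta^A(x)}{p_{1,0}}-\frac{(1-\eta^Y_{A=0}(x))(1-\eta^A(x))}{p_{0,0}}$. For $\mathrm{Dis}\in\{\mathrm{DD},\mathrm{DO},\mathrm{PD}\}$ and $\delta\ge0$, $$t_{X,\mathrm{Dis}}(\delta)=\operatorname*{argmin}_t\Big\{|t|:\Big|\int_{\mathcal X}w_{\mathrm{Dis}}(x)\,I\Big(\eta^Y(x)>\tfrac12+\tfrac t2w_{\mathrm{Dis}}(x)\Big)d\mathbb P_X(x)\Big|\le\delta\Big\}.$$ *)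

(* Defs.v *)
From HB Require Import structures.
From mathcomp Require Import all_boot all_order all_algebra.
From mathcomp Require Import all_classical all_reals all_analysis.

Set Implicit Arguments.
Unset Strict Implicit.
Unset Printing Implicit Defensive.

Import Order.TTheory GRing.Theory Num.Theory.
Import numFieldNormedType.Exports.

Local Open Scope classical_set_scope.
Local Open Scope ring_scope.

Definition argmin (T : Type) (R : realType) (S : set T) (F : T -> R) : set T :=
  [set x | S x /\ forall y, S y -> F x <= F y].

Section conditional_probability.
Context (d : measure_display) (Omega : measurableType d) (R : realType).
Variable P : probability Omega R.

Definition Pr (E : set Omega) : R := fine (P E).

(* Elementary conditional probability given an event of positive probability. *)
Definition Pr_given (E F : set Omega) : R := Pr (E `&` F) / Pr F.

(* [g] is a version of z |-> P(E | Z = z), with values in [0,1]. *)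
Definition is_cond_prob (d' : measure_display) (T : measurableType d')
    (Z : Omega -> T) (E : set Omega) (g : T -> R) : Prop :=
  [/\ measurable_fun setT g,
      forall z, 0 <= g z <= 1 &
      forall B, measurable B ->
        P (E `&` Z @^-1` B) = (\int[P]_(w in Z @^-1` B) (g (Z w))%:E)%E].

(* [U] and [V] are conditionally independent given [Z]; since versions exist
   and are almost surely unique, quantifying over all of them is harmless. *)
Definition cond_independent (d1 d2 d3 : measure_display)
    (T1 : measurableType d1) (T2 : measurableType d2) (T3 : measurableType d3)
    (Z : Omega -> T3) (U : Omega -> T1) (V : Omega -> T2) : Prop :=
  forall (B1 : set T1) (B2 : set T2), measurable B1 -> measurable B2 ->
  forall g1 g2 : T3 -> R,
    is_cond_prob Z (U @^-1` B1) g1 -> is_cond_prob Z (V @^-1` B2) g2 ->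
    is_cond_prob Z (U @^-1` B1 `&` V @^-1` B2) (fun z => g1 z * g2 z).

Definition has_pdf (Z : Omega -> R) : Prop :=
  exists g : R -> R,
    [/\ measurable_fun setT g, forall r, 0 <= g r &
        forall B : set R, measurable B ->
          P (Z @^-1` B) = (\int[lebesgue_measure]_(r in B) (g r)%:E)%E].

End conditional_probability.

(* DD: demographic parity; DO: equality of opportunity;
   PD: predictive equality. *)
Inductive disparity := DD | DO | PD.

Section fair_classification.
Context (d d' : measure_display) (Omega : measurableType d)
  (T : measurableType d') (R : realType).
Variables (P : probability Omega R) (X : {RV P >-> T}) (A Y : {RV P >-> bool}).

Definition classifier : set (T -> R) :=
  [set f : T -> R | measurable_fun setT f /\ forall x, 0 <= f x <= 1].

(* [Yf] | X ~ Bernoulli(f(X)), and [Yf] is conditionally independent of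
   (A, Y) given X. *)
Definition is_prediction (f : T -> R) (Yf : {RV P >-> bool}) : Prop :=
  (forall S : set bool, measurable S ->
     is_cond_prob P X (Yf @^-1` S) (fun x => fine (bernoulli_prob (f x) S)))
  /\ cond_independent P X Yf (fun w => (A w, Y w)).

Definition p_A (a : bool) : R := Pr P [set w | A w = a].
Definition p_AY (a y : bool) : R := Pr P [set w | A w = a /\ Y w = y].

(* [Yhat f] is the randomized prediction attached to the classifier [f]. *)
Variable Yhat : (T -> R) -> {RV P >-> bool}.

Definition risk (f : T -> R) : R := Pr P [set w | Y w <> Yhat f w].

Definition Dis (D : disparity) (f : T -> R) : R :=
  let pos := [set w | Yhat f w = true] in
  match D with
  | DD => Pr_given P pos [set w | A w = true]
          - Pr_given P pos [set w | A w = false]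
  | DO => Pr_given P pos [set w | A w = true /\ Y w = true]
          - Pr_given P pos [set w | A w = false /\ Y w = true]
  | PD => Pr_given P pos [set w | A w = true /\ Y w = false]
          - Pr_given P pos [set w | A w = false /\ Y w = false]
  end.

Definition fair_bayes_optimal (D : disparity) (delta : R) : set (T -> R) :=
  argmin [set f | classifier f /\ `|Dis D f| <= delta] risk.

(* [a] and [y] are cast from bool to {0,1}. *)
Definition fcsc_weight (D : disparity) (t : R) (a y : bool) : R :=
  match D with
  | DD => 1 / 2 + (2 * a%:R - 1) * (1 - 2 * y%:R) * t / (2 * p_A a)
  | DO => 1 / 2 + (1 - 2 * a%:R) * y%:R * t / (2 * p_AY a y)
  | PD => 1 / 2 + (2 * a%:R - 1) * (1 - y%:R) * t / (2 * p_AY a y)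
  end.

Definition fcsc_risk (D : disparity) (t : R) (f : T -> R) : R :=
  \sum_(a : bool) \sum_(y : bool)
    fcsc_weight D t a y
    * Pr P [set w | [/\ Yhat f w = ~~ y, Y w = y & A w = a]].

Variables (etaY etaA : T -> R) (etaYA : bool -> T -> R).

Definition weight (D : disparity) (x : T) : R :=
  match D with
  | DD => etaA x / p_A true - (1 - etaA x) / p_A false
  | DO => etaYA true x * etaA x / p_AY true true
          - etaYA false x * (1 - etaA x) / p_AY false true
  | PD => (1 - etaYA true x) * etaA x / p_AY true false
          - (1 - etaYA false x) * (1 - etaA x) / p_AY false false
  end.

Definition threshold_disparity (D : disparity) (t : R) : R :=
  \int[distribution P X]_x
    (weight D x * \1_[set z | etaY z > 1 / 2 + t / 2 * weight D z] x).

(* An element of the argmin; the default 0 is only returned if it is empty. *)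
Definition t_X (D : disparity) (delta : R) : R :=
  xget 0 (argmin [set t : R | `|threshold_disparity D t| <= delta]
                 (fun t => `|t|)).

End fair_classification.

(* Main.v *)
(** Each disparity is a linear functional f |-> E[f(X) w(X)], and the
    cost-sensitive risk with parameter t is, up to an additive constant, half
    of the Lagrangian R(f) + t Dis(f).  Since the Lagrangian is the integral of
    f (1 - 2 eta + t w) up to a constant, and the boundary set is null, a
    minimiser agrees a.s. with the indicator of eta > 1/2 + t w / 2; hence its
    disparity is D(t) = E[w 1(eta > 1/2 + t w / 2)].  The function D is
    continuous (dominated convergence) and nonincreasing, and tends to
    - E[w^-] < 0 < E[w^+] at +oo and -oo because E[w] = 0 and w is a.s. nonzero.
    So a smallest |t| with |D(t)| <= delta exists and satisfies complementary
    slackness t D(t) = delta |t|, which turns Lagrangian optimality into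
    constrained optimality. *)

Require Import Defs.
From HB Require Import structures.
From mathcomp Require Import all_boot all_order all_algebra.
From mathcomp Require Import all_classical all_reals all_analysis.
From mathcomp Require Import measurable_realfun.
From mathcomp Require Import ring lra.

Import Order.TTheory GRing.Theory Num.Theory.
Import numFieldNormedType.Exports.

Local Open Scope classical_set_scope.
Local Open Scope ring_scope.

Set Implicit Arguments.
Unset Strict Implicit.
Unset Printing Implicit Defensive.

(** * Bounded integrands and boolean indicators *)

Lemma integrable_of_bound d (T : measurableType d) (R : realType)
    (mu : {finite_measure set T -> \bar R}) (M : R) (f : T -> R) :
  measurable_fun setT f -> (forall x, `|f x| <= M) ->
  mu.-integrable setT (EFin \o f).
Proof.
move=> mf fM; apply: (@le_integrable _ _ _ mu _ measurableT _ (EFin \o cst M)).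
- exact/measurable_EFinP.
- by move=> x _ /=; rewrite lee_fin (le_trans (fM x))// ler_norm.
- exact: finite_measure_integrable_cst.
Qed.

Lemma indic_bool (T : Type) (R : pzRingType) (p : pred T) x :
  \1_[set z | p z] x = (p x)%:R :> R.
Proof. by rewrite indicE; congr ((nat_of_bool _)%:R); apply/idP/idP; rewrite inE. Qed.

(** * The disparity of a threshold rule as a function of its multiplier *)

Section threshold.
Context d (T : measurableType d) (R : realType) (mu : probability T R).
Variables (eta w : T -> R) (M : R).
Hypotheses (meta : measurable_fun setT eta) (mw : measurable_fun setT w).
Hypothesis wM : forall x, `|w x| <= M.

Definition level_set (t : R) : set T := [set z | eta z > 1 / 2 + t / 2 * w z].

Definition level_integral (t : R) : R := \int[mu]_x (w x * \1_(level_set t) x).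

Lemma measurable_level_set t : measurable (level_set t).
Proof.
have mg : measurable_fun setT (fun x => 1 / 2 + t / 2 * w x).
  by apply: measurable_funD => //; exact: measurable_funM.
have := measurable_fun_ltr mg meta measurableT (Y := [set true]) I.
by rewrite setTI.
Qed.

Lemma measurable_level_boundary t :
  measurable [set x | eta x = 1 / 2 + t / 2 * w x].
Proof.
have mg : measurable_fun setT (fun x => 1 / 2 + t / 2 * w x).
  by apply: measurable_funD => //; exact: measurable_funM.
have := measurable_fun_eqr meta mg measurableT (Y := [set true]) I.
by rewrite setTI; congr measurable; apply/seteqP; split => x /= /eqP.
Qed.

Let mlevel t : measurable_fun setT (fun x => w x * \1_(level_set t) x).
Proof.
by apply: measurable_funM => //; apply: measurable_indic; exact: measurable_level_set.
Qed.

Let level_le t x : `|w x * \1_(level_set t) x| <= M.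
Proof.
rewrite indicE; case: (x \in _); rewrite ?mulr1 ?mulr0 ?normr0//.
exact: le_trans (wM x).
Qed.

Let ilevel t : mu.-integrable setT (EFin \o (fun x => w x * \1_(level_set t) x)).
Proof. exact: (integrable_of_bound _ (@mlevel t) (@level_le t)). Qed.

(** Raising the multiplier raises the threshold where [w] is nonnegative, so the indicator can only
    drop, and lowers it where [w] is negative, so the indicator can only grow. The product with [w]
    decreases pointwise either way. *)
Lemma level_integral_nonincreasing s t :
  s <= t -> level_integral t <= level_integral s.
Proof.
move=> st; apply: le_Rintegral => // x _.
rewrite /level_set !indic_bool.
have [w0|w0] := leP 0 (w x).
- apply: (ler_wpM2l w0); rewrite ler_nat.
  case: (ltP _ (eta x)) => //= h1; case: (ltP _ (eta x)) => //= h2.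
  by have := ler_wpM2r w0 st; lra.
- apply: (ler_wnM2l (ltW w0)); rewrite ler_nat.
  case: (ltP _ (eta x)) => //= h1; case: (ltP _ (eta x)) => //= h2.
  by have := ler_wnM2r (ltW w0) st; lra.
Qed.

Hypothesis boundary :
  forall t, mu [set x | eta x = 1 / 2 + t / 2 * w x] = 0%E.

(** Dominated convergence with the constant bound [M]. It serves both for continuity at a point and
    for the limit of the multiplier at infinity. *)
Lemma level_integral_cvg (u : nat -> R) (h : T -> R) :
  {ae mu, forall x, w x * \1_(level_set (u n)) x @[n --> \oo] --> h x} ->
  measurable_fun setT h ->
  level_integral (u n) @[n --> \oo] --> \int[mu]_x h x.
Proof.
move=> uh mh.
have [||||//|ih _ cv] := @dominated_convergence _ T R mu setT measurableT
   (fun n x => (w x * \1_(level_set (u n)) x)%:E) (EFin \o h) (EFin \o cst M).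
- by move=> n; exact/measurable_EFinP.
- exact/measurable_EFinP.
- apply: filterS uh => x ux _; apply: cvg_EFin; first exact: nearW.
  exact: ux.
- exact: finite_measure_integrable_cst.
- by apply: aeW => x n _ /=; rewrite lee_fin.
apply: fine_cvg; rewrite fineK//.
exact: integrable_fin_num.
Qed.

(** Off the boundary set of [a], [eta x] differs strictly from the threshold, and the strict
    inequality persists along [u]. The indicator is therefore eventually constant at almost every
    point. *)
Lemma level_integral_continuous : continuous level_integral.
Proof.
move=> a; apply/(@cvg_nbhsP _ R^o) => u ua.
apply: level_integral_cvg; last exact: mlevel.
exists [set x | eta x = 1 / 2 + a / 2 * w x]; split => [||x /=].
- exact: measurable_level_boundary.
- exact: boundary.
apply: contra_notP => /eqP nx; apply: cvg_near_cst.
have cv : 1 / 2 + u n / 2 * w x @[n --> \oo] --> 1 / 2 + a / 2 * w x.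
  by apply: cvgD; [exact: cvg_cst|]; do 2 (apply: cvgMl || apply: cvgMr).
have [lt_eta|gt_eta|eq_eta] := ltgtP (eta x) (1 / 2 + a / 2 * w x).
- near=> n; rewrite /level_set !indic_bool (lt_gtF lt_eta).
  rewrite ltNge (_ : eta x <= _)//.
  by near: n; exact: (cvgr_ge _ cv).
- near=> n; rewrite /level_set !indic_bool gt_eta.
  rewrite (_ : _ < eta x = true)//.
  by near: n; exact: (cvgr_lt _ cv).
- by rewrite eq_eta eqxx in nx.
Unshelve. all: by end_near. Qed.

Hypothesis w_int0 : \int[mu]_x w x = 0.
Hypothesis w_neq0 : mu [set x | w x = 0] = 0%E.
Hypothesis etaM : forall x, 0 <= eta x <= 1.

Let m0 : measurable [set x | w x < 0].
Proof.
have := measurable_fun_ltr mw (measurable_cst (0 : R)) measurableT (Y := [set true]) I.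
by rewrite setTI.
Qed.

Let iw : mu.-integrable setT (EFin \o w).
Proof. exact: integrable_of_bound wM. Qed.

(** Otherwise the mean of [|w|] is at most the mean of [w], which is zero, so [w] vanishes almost
    everywhere; this contradicts [w_neq0]. *)
Lemma neg_part_integral_lt0 : \int[mu]_x (w x * \1_[set x | w x < 0] x) < 0.
Proof.
have mneg : measurable_fun setT (fun x => w x * \1_[set x | w x < 0] x).
  by apply: measurable_funM => //; exact: measurable_indic.
have ineg : mu.-integrable setT (EFin \o (fun x => w x * \1_[set x | w x < 0] x)).
  apply: (@integrable_of_bound _ _ _ mu M) => // x.
  by rewrite indicE; case: (_ \in _); rewrite ?mulr1 ?mulr0 ?normr0// (le_trans _ (wM x)).
rewrite ltNge; apply/negP => neg_ge0.
have iabs : mu.-integrable setT (EFin \o (fun x => `|w x|)).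
  apply: (@integrable_of_bound _ _ _ mu M) => [|x]; last by rewrite normr_id.
  exact: measurableT_comp.
have int_abs : \int[mu]_x `|w x| = 0.
  apply/eqP; rewrite eq_le Rintegral_ge0// andbT.
  (* The negative part is counted twice with the opposite sign: [|w| = w - 2 w 1(w < 0)]. *)
  have -> : \int[mu]_x `|w x| =
      \int[mu]_x (w x - 2 * (w x * \1_[set x | w x < 0] x)).
    apply: eq_Rintegral => x _; rewrite indic_bool.
    by case: ltP => wx /=; [rewrite ltr0_norm//|rewrite ger0_norm//]; ring.
  have i2 : mu.-integrable setT
      (EFin \o (fun x => 2 * (w x * \1_[set x | w x < 0] x))).
    exact: (integrableZl measurableT 2 ineg).
  by rewrite RintegralB// RintegralZl// w_int0 sub0r oppr_le0 mulr_ge0.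
have ae0 : ae_eq mu setT (EFin \o w) (cst 0%E).
  apply/ae_eq_integral_abs => //; first exact/measurable_EFinP.
  rewrite -[LHS]fineK; first by rewrite -[0%E]/(0%:E) -int_abs.
  exact: (integrable_fin_num measurableT iabs).
case: ae0 => N [mN N0 sub].
have mw0 : measurable [set x | w x = 0].
  have := mw measurableT (measurable_set1 0); by rewrite setTI.
(* Both [w = 0] and its complement would be null, although [mu] has total mass one. *)
have : mu (~` [set x | w x = 0]) = 0%E.
  apply: (subset_measure0 _ _ _ N0) => //; first exact: measurableC.
  apply: subset_trans sub => x /= wx /(_ I) [].
  exact: wx.
by rewrite probability_setC// w_neq0 sube0 => /eqP; rewrite onee_eq0.
Qed.

(** Along multipliers [n] tending to infinity the integrand tends to [w 1(w < 0)]. The limit of the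
    integrals is strictly negative, so the bound is reached even for [delta = 0]. *)
Lemma level_integral_le (delta : R) :
  0 <= delta -> exists t, level_integral t <= delta.
Proof.
move=> delta0.
have mneg : measurable_fun setT (fun x => w x * \1_[set x | w x < 0] x).
  by apply: measurable_funM => //; exact: measurable_indic.
have cv : level_integral n%:R @[n --> \oo] -->
    \int[mu]_x (w x * \1_[set x | w x < 0] x).
  apply: level_integral_cvg => //; apply: aeW => x.
  have [wx|wx|wx] := ltgtP (w x) 0.
  - apply: cvg_near_cst; near=> n.
    rewrite /level_set !indic_bool wx (_ : _ < eta x = true)//.
    (* As [eta] lies in [0,1], the comparison is settled once [n |w x| > 1]: the threshold is then
       negative here, and above 1 in the case of positive [w x]. *)
    have : 1 / - w x < n%:R by near: n; exact: nbhs_infty_gtr.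
    rewrite ltr_pdivrMr ?oppr_gt0// => h.
    by have /andP[e0 _] := etaM x; lra.
  - apply: cvg_near_cst; near=> n.
    rewrite /level_set !indic_bool (lt_gtF wx) (_ : _ < eta x = false)//.
    have : 1 / w x < n%:R by near: n; exact: nbhs_infty_gtr.
    rewrite ltr_pdivrMr// => h.
    by have /andP[_ e1] := etaM x; apply/negbTE; rewrite -leNgt; lra.
  - rewrite wx mul0r; apply: cvg_near_cst; apply: nearW => n.
    by rewrite mul0r.
have lt_delta : \int[mu]_x (w x * \1_[set x | w x < 0] x) < delta.
  exact: lt_le_trans neg_part_integral_lt0 delta0.
have [N _ NP] := cvgr_lt _ cv _ lt_delta.
exists N%:R; exact/ltW/NP/leqnn.
Unshelve. all: by end_near. Qed.

End threshold.

(** Changing the sign of both [w] and [t] keeps the level set and flips the integrand. This turns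
    the upper bound for large multipliers into a lower bound for very negative ones. *)
Lemma level_integral_oppr d (T : measurableType d) (R : realType)
    (mu : probability T R) (eta w : T -> R) (t : R) (M : R) :
  measurable_fun setT eta -> measurable_fun setT w -> (forall x, `|w x| <= M) ->
  level_integral mu eta (fun x => - w x) (- t) = - level_integral mu eta w t.
Proof.
move=> meta mw wM.
have il : mu.-integrable setT (EFin \o (fun x => w x * \1_(level_set eta w t) x)).
  apply: (@integrable_of_bound _ _ _ mu M) => [|x].
    by apply: measurable_funM => //; apply: measurable_indic; exact: measurable_level_set.
  rewrite indicE; case: (x \in _); rewrite ?mulr1 ?mulr0 ?normr0//.
  exact: le_trans (wM x).
rewrite -[RHS]mulN1r /level_integral -RintegralZl//.
apply: eq_Rintegral => x _; rewrite /level_set !indic_bool.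
by rewrite !mulNr !mulrN opprK !mul1r.
Qed.

(** * Existence of a smallest feasible multiplier and complementary slackness *)

Section optimal_threshold.
Context d (T : measurableType d) (R : realType) (mu : probability T R).
Variables (eta w : T -> R) (M : R).
Hypotheses (meta : measurable_fun setT eta) (mw : measurable_fun setT w).
Hypothesis wM : forall x, `|w x| <= M.
Hypothesis boundary :
  forall t, mu [set x | eta x = 1 / 2 + t / 2 * w x] = 0%E.
Hypothesis w_int0 : \int[mu]_x w x = 0.
Hypothesis w_neq0 : mu [set x | w x = 0] = 0%E.
Hypothesis etaM : forall x, 0 <= eta x <= 1.
Variable delta : R.
Hypothesis delta_ge0 : 0 <= delta.

Local Notation D := (level_integral mu eta w).
Local Notation D_continuous := (level_integral_continuous meta mw wM boundary).
Local Notation D_nonincreasing := (level_integral_nonincreasing mu meta mw wM).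

Let level_integral_IVT a b v : a <= b -> D b <= v <= D a ->
  exists2 c, c \in `[a, b] & D c = v.
Proof.
move=> ab Dv; have cD : {within `[a, b], continuous D}.
  exact/continuous_subspaceT/D_continuous.
by apply: IVT => //; rewrite (min_r (D_nonincreasing ab)) (max_l (D_nonincreasing ab)).
Qed.

Lemma level_integral_feasible : exists t, `|D t| <= delta.
Proof.
have [a Da] := level_integral_le meta mw wM w_int0 w_neq0 etaM delta_ge0.
(* Apply the upper bound to [- w], whose mean is zero and which is almost surely nonzero as well,
   then reflect. *)
have [b Db] : exists b, - delta <= D b.
  have [||||b] := @level_integral_le _ T R mu eta (fun x => - w x) M
      meta _ _ _ _ etaM _ delta_ge0.
  - exact: measurableT_comp.
  - by move=> x; rewrite normrN.
  - by under eq_Rintegral do rewrite -mulN1r; rewrite RintegralZl// ?w_int0 ?mulr0//;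
      exact: integrable_of_bound wM.
  - rewrite -w_neq0; congr (mu _); apply/seteqP; split => x /= /eqP;
      rewrite ?oppr_eq0 => /eqP // ->; rewrite oppr0//.
  - rewrite -{1}(opprK b) (level_integral_oppr _ _ meta mw wM) => h.
    by exists (- b); rewrite lerNl.
have [Da'|Da'] := leP (- delta) (D a); first by exists a; rewrite ler_norml Da' Da.
have [Db'|Db'] := leP (D b) delta; first by exists b; rewrite ler_norml Db' Db.
(* Now [D a < - delta] and [delta < D b], so monotonicity puts [b] to the left of [a], and the value
   [delta] is attained in between. *)
have ba : b <= a.
  rewrite leNgt; apply/negP => /ltW /D_nonincreasing; lra.
have [|c _ Dc] := level_integral_IVT (v := delta) ba; first by lra.
by exists c; rewrite Dc ger0_norm.
Qed.

(** Given a feasible [s], only multipliers in the segment from [- |s|] to [|s|] compete. The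
    feasible ones among them form a compact set, by continuity of [D]. *)
Lemma level_integral_argmin_neq0 :
  argmin [set t | `|D t| <= delta] (fun t => `|t|) !=set0.
Proof.
have [s Ds] := level_integral_feasible.
have [|||c] := @compact_EVT_min _ R (fun t : R => `|t|)
    (`[- `|s|, `|s|] `&` [set t | `|D t| <= delta]).
- by exists s; split => //=; rewrite in_itv/= -ler_norml.
- apply: compact_closedI; first exact: segment_compact.
  have cD : continuous (fun t => `|D t|).
    by move=> t; apply: cvg_norm; exact: D_continuous.
  exact: (closed_comp (fun t _ => cD t) (@closed_le R delta)).
- exact/continuous_subspaceT/norm_continuous.
rewrite inE => -[cs /= Dc] cmin; exists c; split => // t Dt.
have [ts|st] := leP `|t| `|s|.
  by apply: cmin; rewrite inE; split => //=; rewrite in_itv/= -ler_norml.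
by apply: le_trans (ltW st); rewrite ler_norml; rewrite /= in_itv in cs.
Qed.

(* Complementary slackness: a nonzero multiplier of minimal size saturates the constraint. *)
Lemma argmin_threshold_slackness t v :
  argmin [set t | `|D t| <= delta] (fun t => `|t|) t -> `|v| <= delta ->
  t * v <= t * D t.
Proof.
move=> [/= Dt tmin] vdelta.
move: (Dt); rewrite ler_norml => /andP[Dt1 Dt2].
move: vdelta; rewrite ler_norml => /andP[v1 v2].
have [t0|t0|->] := ltgtP t 0; last by rewrite !mul0r.
- rewrite ler_nM2l//; apply: le_trans v1.
  (* If [0] were feasible, minimality would give [t = 0]; hence [D 0] lies below [- delta]. The
     value [- delta] is then attained at some [c] between [t] and [0], and minimality forces
     [c = t]. *)
  have D0 : D 0 <= D t by apply: D_nonincreasing; exact: ltW.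
  have D0d : D 0 < - delta.
    rewrite ltNge; apply/negP => D0'.
    have /tmin : `|D 0| <= delta by rewrite ler_norml; lra.
    by rewrite normr0 normr_le0 lt_eqF.
  have [|c] := level_integral_IVT (v := - delta) (ltW t0); first by lra.
  rewrite in_itv/= => /andP[tc c0] Dc.
  have /tmin : `|D c| <= delta by rewrite Dc normrN ger0_norm.
  rewrite ltr0_norm// ler0_norm// lerN2 => ct.
  by rewrite -Dc (@le_anti _ _ c t)// ct.
(* The mirror image: for positive [t] the active bound is [delta]. *)
- rewrite ler_pM2l//; apply: le_trans v2 _.
  have D0 : D t <= D 0 by apply: D_nonincreasing; exact: ltW.
  have D0d : delta < D 0.
    rewrite ltNge; apply/negP => D0'.
    have /tmin : `|D 0| <= delta by rewrite ler_norml; lra.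
    by rewrite normr0 normr_le0 gt_eqF.
  have [|c] := level_integral_IVT (v := delta) (ltW t0); first by lra.
  rewrite in_itv/= => /andP[c0 ct] Dc.
  have /tmin : `|D c| <= delta by rewrite Dc ger0_norm.
  rewrite gtr0_norm// ger0_norm// => tc.
  by rewrite -Dc (@le_anti _ _ c t)// ct.
Qed.

End optimal_threshold.

(** * Minimisers of the Lagrangian are threshold rules almost everywhere *)

Lemma argmin_lagrangian_integral d (T : measurableType d) (R : realType)
    (mu : probability T R) (eta w : T -> R) (M t : R) (f : T -> R) :
  measurable_fun setT eta -> measurable_fun setT w ->
  (forall x, `|w x| <= M) -> (forall x, 0 <= eta x <= 1) ->
  mu [set x | eta x = 1 / 2 + t / 2 * w x] = 0%E ->
  argmin (@classifier d T R)
    (fun g => \int[mu]_x (g x * (1 - 2 * eta x + t * w x))) f ->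
  \int[mu]_x (f x * w x) = level_integral mu eta w t.
Proof.
move=> meta mw wM eta01 boundary [[mf f01] fmin].
(* [k x] is negative exactly when [x] lies in the level set, so [f0] minimises the integrand
   pointwise over values in [0,1]. *)
pose k x := 1 - 2 * eta x + t * w x.
pose f0 : T -> R := \1_(level_set eta w t).
have mf0 : measurable_fun setT f0.
  by apply: measurable_indic; exact: measurable_level_set.
have f0E x : f0 x = (1 / 2 + t / 2 * w x < eta x)%R%:R by rewrite /f0 /level_set indic_bool.
have f0_cl : classifier f0.
  by split=> // x; rewrite f0E; case: ltP; rewrite ?lexx ler01.
have mk : measurable_fun setT k.
  apply: measurable_funD; last exact: measurable_funM.
  by apply: measurable_funB => //; exact: measurable_funM.
(* The 3 is a crude bound for [|1 - 2 eta x|]; only finiteness matters. *)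
have kM x : `|k x| <= 3 + `|t| * M.
  apply: le_trans (ler_normD _ _) _; apply: lerD.
    by rewrite ler_norml; have /andP[] := eta01 x; lra.
  by rewrite normrM ler_wpM2l.
have ig g : classifier g -> mu.-integrable setT (EFin \o (fun x => g x * k x)).
  move=> [mg g01]; apply: (@integrable_of_bound _ _ _ mu (3 + `|t| * M)).
    exact: measurable_funM.
  move=> x; rewrite normrM; apply: le_trans (kM x).
  by apply: ler_piMl => //; have /andP[? ?] := g01 x; rewrite ger0_norm.
(* The excess of [f] over [f0] is pointwise nonnegative, while minimality of [f] makes its integral
   at most zero. It is therefore zero almost everywhere. *)
pose e x := f x * k x - f0 x * k x.
have e_ge0 x : 0 <= e x.
  rewrite /e -mulrBl f0E; have /andP[fx0 fx1] := f01 x.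
  by case: ltP => h /=; [apply: mulr_le0|apply: mulr_ge0]; rewrite /k; lra.
have ie : mu.-integrable setT (EFin \o e).
  exact: (integrableB measurableT (ig f (conj mf f01)) (ig f0 f0_cl)).
have int_e : \int[mu]_x e x = 0.
  apply/eqP; rewrite eq_le Rintegral_ge0// andbT.
  rewrite RintegralB//; [|exact: ig|exact: ig].
  by rewrite subr_le0; exact: fmin.
have ae0 : ae_eq mu setT (EFin \o e) (cst 0%E).
  apply/ae_eq_integral_abs => //; first exact: measurable_int ie.
  under eq_integral do rewrite /= ger0_norm//.
  rewrite -[LHS]fineK; first by rewrite -[0%E]/(0%:E) -int_e.
  exact: (integrable_fin_num measurableT ie).
congr fine; apply: ae_eq_integral => //.
- by apply/measurable_EFinP; exact: measurable_funM.
- by apply/measurable_EFinP; exact: measurable_funM.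
case: ae0 => N [mN N0 sub].
exists (N `|` [set x | eta x = 1 / 2 + t / 2 * w x]); split.
- by apply: measurableU => //; exact: measurable_level_boundary.
- by apply: null_set_setU => //; exact: measurable_level_boundary.
(* Off the boundary [k x] is nonzero, so a vanishing excess forces [f x = f0 x]. *)
- move=> x /= fx; have [|nb] := pselect (eta x = 1 / 2 + t / 2 * w x); [by right|left].
  apply: sub => /= /(_ I) [] ex; apply: fx => _; congr EFin.
  rewrite mulrC; congr (_ * _); rewrite -/(f0 x).
  have : (f x - f0 x) * k x = 0 by rewrite mulrBl.
  move/eqP; rewrite mulf_eq0 => /orP[/eqP|/eqP kx].
    by move/eqP; rewrite subr_eq0 => /eqP.
  by case: nb; rewrite /k in kx; lra.
Qed.

(** * Exchanging a function for its conditional expectation *)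

Section tower.
Context d d' (Omega : measurableType d) (T : measurableType d') (R : realType).
Variables (P : {measure set Omega -> \bar R}) (Z : Omega -> T).
Hypothesis mZ : measurable_fun setT Z.
Import HBNNSimple.
Local Open Scope ereal_scope.

Let integral_approx (phi : Omega -> \bar R) (h : {nnsfun T >-> R}) :
  measurable_fun setT phi -> (forall w, 0 <= phi w) ->
  \int[P]_w ((h (Z w))%:E * phi w) =
  \sum_(y \in range h) y%:E * \int[P]_(w in Z @^-1` (h @^-1` [set y])) phi w.
Proof.
move=> mphi phi0.
have mh y : measurable (Z @^-1` (h @^-1` [set y])).
  by rewrite -[X in measurable X]setTI; apply: mZ => //; exact: measurable_sfunP.
transitivity (\int[P]_w \sum_(y \in range h)
   ((y * \1_(h @^-1` [set y]) (Z w))%:E * phi w)).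
  apply: eq_integral => w _.
  rewrite -ge0_mule_fsuml => [|y]; last exact: nnfun_muleindic_ge0.
  by rewrite fsumEFin// -(fimfunE h).
rewrite ge0_integral_fsum//; last 2 first.
- move=> y; apply: emeasurable_funM => //; apply/measurable_EFinP.
  by apply: measurable_funM => //; apply: measurableT_comp mZ.
- by move=> y w _; rewrite mule_ge0// nnfun_muleindic_ge0.
apply: eq_fsbigr => y; rewrite inE => -[x _ <-].
rewrite [in RHS]integral_mkcond -ge0_integralZl//; last 3 first.
- exact/(measurable_restrictT _ (mh _))/measurable_funTS.
- by move=> w _; rewrite patchE; case: ifP.
- by rewrite lee_fin.
apply: eq_integral => w _; rewrite EFinM -muleA; congr (_ * _).
rewrite patchE indicE -[w \in _]/(Z w \in h @^-1` [set h x]).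
by case: ifP; rewrite ?mul1e ?mul0e.
Qed.

(** Equality on the events generated by [Z] passes to simple functions of [Z], then to nonnegative
    ones by monotone convergence. With [phi] an indicator and [psi] its conditional probability,
    this pulls functions of [Z] out of a conditioning. *)
Lemma integral_tower (phi psi : Omega -> R) (h : T -> \bar R) :
  measurable_fun setT phi -> (forall w, 0 <= phi w)%R ->
  measurable_fun setT psi -> (forall w, 0 <= psi w)%R ->
  (forall B, measurable B ->
    \int[P]_(w in Z @^-1` B) (phi w)%:E = \int[P]_(w in Z @^-1` B) (psi w)%:E) ->
  measurable_fun setT h -> (forall z, 0 <= h z) ->
  \int[P]_w (h (Z w) * (phi w)%:E) = \int[P]_w (h (Z w) * (psi w)%:E).
Proof.
move=> mphi phi0 mpsi psi0 phipsi mh h0.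
pose hn := nnsfun_approx measurableT mh.
have lim_int (f : Omega -> R) : measurable_fun setT f -> (forall w, 0 <= f w)%R ->
    \int[P]_w (h (Z w) * (f w)%:E) =
    limn (fun n => \int[P]_w ((hn n (Z w))%:E * (f w)%:E)).
  move=> mf f0; rewrite -monotone_convergence//.
  - apply: eq_integral => w _; apply/esym/cvg_lim => //.
    apply: cvgeZr => //; exact: cvg_nnsfun_approx.
  - move=> n; apply: emeasurable_funM; last exact/measurable_EFinP.
    by apply/measurable_EFinP; exact: measurableT_comp mZ.
  - by move=> n w _; rewrite mule_ge0// lee_fin.
  - move=> w _ m n mn; rewrite lee_wpmul2r// ?lee_fin//.
    exact/lefP/nd_nnsfun_approx.
rewrite !lim_int//; congr (limn _); apply/funext => n.
rewrite !(integral_approx (phi := EFin \o _))//;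
  [|exact/measurable_EFinP|exact/measurable_EFinP].
by apply: eq_fsbigr => y _; congr (_ * _); exact: phipsi.
Qed.

End tower.

(** * Calculus of conditional probabilities *)

Section conditional_probability.
Context d d' (Omega : measurableType d) (T : measurableType d') (R : realType).
Variable P : probability Omega R.

Lemma measurable_preimageT (Z : Omega -> T) (B : set T) :
  measurable_fun setT Z -> measurable B -> measurable (Z @^-1` B).
Proof. by move=> mZ mB; rewrite -[X in measurable X]setTI; exact: mZ. Qed.

Lemma is_cond_prob_setC (Z : Omega -> T) (E : set Omega) (g : T -> R) :
  measurable_fun setT Z -> measurable E ->
  is_cond_prob P Z E g -> is_cond_prob P Z (~` E) (fun z => 1 - g z).
Proof.
move=> mZ mE [mg g01 gE]; split.
- exact: measurable_funB.
- by move=> z; have := g01 z; lra.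
move=> B mB; have mZB := measurable_preimageT mZ mB.
have iZ : P.-integrable (Z @^-1` B) (EFin \o (g \o Z)).
  apply: (integrableS measurableT) => //.
  apply: (@integrable_of_bound _ _ _ P 1); first exact: measurableT_comp.
  by move=> w /=; have /andP[? ?] := g01 (Z w); rewrite ger0_norm.
under eq_integral do rewrite EFinB.
rewrite integralB//; last exact: finite_measure_integrable_cst.
rewrite -gE// integral_cst// mul1e.
rewrite setIC -setDE measureD// ?ltey_eq ?fin_num_measure// setIC //.
Qed.

(** The chain rule P(E, A = a | X) = P(E | A = a, X) P(A = a | X). On the event [A = a] the version
    [h (A, X)] is the function [h (a, X)] of [X] alone, so [integral_tower] may replace the
    indicator of that event by [g (X)]. *)
Lemma is_cond_prob_chain
    (X : Omega -> T) (A : Omega -> bool)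
    (E : set Omega) (a : bool) (g : T -> R) (h : bool * T -> R) :
  measurable_fun setT X -> measurable_fun setT A ->
  is_cond_prob P X [set w | A w = a] g ->
  is_cond_prob P (fun w => (A w, X w)) E h ->
  is_cond_prob P X (E `&` [set w | A w = a]) (fun x => h (a, x) * g x).
Proof.
move=> mX mA [mg g01 gE] [mh h01 hE].
have mha : measurable_fun setT (fun x => h (a, x)) by exact: measurableT_comp.
have mAa : measurable [set w | A w = a].
  by have := mA measurableT [set a] I; rewrite setTI.
split.
- exact: measurable_funM.
- by move=> x; have := g01 x; have := h01 (a, x); nra.
move=> B mB; have mXB := measurable_preimageT mX mB.
have -> : E `&` [set w | A w = a] `&` X @^-1` B =
    E `&` (fun w => (A w, X w)) @^-1` ([set a] `*` B).
  by apply/seteqP; split => w /=; tauto.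
rewrite hE; last exact: measurableX.
have -> : (fun w => (A w, X w)) @^-1` ([set a] `*` B) =
    X @^-1` B `&` [set w | A w = a].
  by apply/seteqP; split => w /=; tauto.
pose hB (x : T) : \bar R := (h (a, x) * \1_B x)%:E.
transitivity (\int[P]_w (hB (X w) * (\1_[set w | A w = a] w)%:E))%E.
  rewrite [LHS]integral_mkcond; apply: eq_integral => w _.
  rewrite patchE /hB in_setI !indicE -[w \in X @^-1` B]/(X w \in B).
  have [XB|] := boolP (X w \in B); last by rewrite mulr0 mul0e.
  have [/set_mem /= <-|_] := boolP (w \in [set w | A w = a]).
    by rewrite mulr1 mule1.
  by rewrite mule0.
rewrite (integral_tower mX (psi := g \o X)) //.
- rewrite [RHS]integral_mkcond; apply: eq_integral => w _.
  rewrite patchE /hB indicE -[w \in X @^-1` B]/(X w \in B).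
  by case: ifP => _; [rewrite mulr1 EFinM|rewrite mulr0 mul0e].
- exact: measurableT_comp.
- by move=> w; have /andP[] := g01 (X w).
- move=> C mC; rewrite -gE// integral_indic//.
  exact: measurable_preimageT.
- apply/measurable_EFinP; apply: measurable_funM => //.
- by move=> x; rewrite lee_fin mulr_ge0//; have /andP[] := h01 (a, x).
Qed.

Lemma is_cond_prob_Pr (X : {RV P >-> T}) (E : set Omega) (g : T -> R) :
  is_cond_prob P X E g -> Pr P E = \int[distribution P X]_x g x.
Proof.
move=> [mg g01 gE]; rewrite /Pr /Rintegral; congr fine.
have := gE setT measurableT; rewrite preimage_setT setIT => ->.
rewrite ge0_integral_distribution//; first exact/measurable_EFinP.
by move=> x; rewrite lee_fin; have /andP[] := g01 x.
Qed.

(** [E] is the preimage of the rectangle [U] times [V] under (A, Y), so conditional independence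
    makes the product of the Bernoulli probability [f] and [g] a version for the intersection. *)
Lemma prediction_Pr (X : {RV P >-> T}) (A Y Yf : {RV P >-> bool})
    (f g : T -> R) (E : set Omega) (U V : set bool) :
  classifier f -> is_prediction X A Y f Yf ->
  E = [set w | U (A w) /\ V (Y w)] -> is_cond_prob P X E g ->
  Pr P ([set w | Yf w = true] `&` E) = \int[distribution P X]_x (f x * g x).
Proof.
move=> [mf f01] [bern indep] -> Eg; apply: is_cond_prob_Pr.
have bf x : fine (bernoulli_prob (f x) [set true]) = f x.
  rewrite bernoulli_probE// !diracE.
  rewrite (mem_set (erefl true : [set true] true)) memNset // mulr1n mulr0n.
  by rewrite mule1 mule0 adde0.
have -> : (fun x => f x * g x) =
    (fun x => fine (bernoulli_prob (f x) [set true]) * g x).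
  by apply/funext => x; rewrite bf.
exact: (indep [set true] (U `*` V) I (measurableX _ _) _ g (bern _ I) Eg).
Qed.

End conditional_probability.

(** * The eight atoms of three binary variables *)

Section finite_joint_law.
Context d (Omega : measurableType d) (R : realType) (P : probability Omega R).
Implicit Types B C Z : {RV P >-> bool}.

Lemma measurable_eqb B b : measurable [set w | B w = b].
Proof. exact: (measurable_preimageT (B := [set b])). Qed.

Lemma Pr_splitb B (E : set Omega) : measurable E ->
  Pr P E = Pr P (E `&` [set w | B w = true]) + Pr P (E `&` [set w | B w = false]).
Proof.
move=> mE; rewrite /Pr -fineD ?fin_num_measure//; try
  by apply: measurableI => //; exact: measurable_eqb.
rewrite -measureU; [|by apply: measurableI => //; exact: measurable_eqb..|].
- congr (fine (P _)); apply/seteqP; split => w /=; last by case=> [[]|[]].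
  by case: (B w) => Ew; [left|right].
- by apply/seteqP; split => w //= [[_ ->] []].
Qed.

Variables (Z A Y : {RV P >-> bool}).

(** The conjuncts stand in the order used by [fcsc_risk], so that this risk is a weighted sum of
    atoms by conversion. *)
Definition joint_law (z a y : bool) : R :=
  Pr P [set w | [/\ Z w = z, Y w = y & A w = a]].

(** Splitting along [Z], [A] and [Y] in turn leaves eight cells, each either an atom or empty.
    Identities between probabilities thereby become polynomial or rational identities in the
    atoms. *)
Lemma Pr_joint_law (p : bool -> bool -> bool -> bool) :
  Pr P [set w | p (Z w) (A w) (Y w)] =
  \sum_(z : bool) \sum_(a : bool) \sum_(y : bool) (p z a y)%:R * joint_law z a y.
Proof.
have mp : measurable [set w | p (Z w) (A w) (Y w)].
  rewrite (_ : [set w | _] = \bigcup_z \bigcup_a \bigcup_y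
     ([set w | Z w = z] `&` [set w | A w = a] `&` [set w | Y w = y]
      `&` [set w : Omega | p z a y])); last first.
    apply/seteqP; split => w /=; first by exists (Z w) => //; exists (A w) => //; exists (Y w).
    by move=> [z _ [a _ [y _ [[[-> ->] ->]]]]].
  do 3 (apply: fin_bigcup_measurable => [|? _]; first exact: finite_finset).
  apply: measurableI; last by case: p; rewrite ?set_true ?set_false.
  by apply: measurableI; [apply: measurableI|]; exact: measurable_eqb.
have mI E B b : measurable E -> measurable (E `&` [set w | B w = b]).
  by move=> mE; apply: measurableI => //; exact: measurable_eqb.
have cell z a y : Pr P ([set w | p (Z w) (A w) (Y w)] `&` [set w | Z w = z]
    `&` [set w | A w = a] `&` [set w | Y w = y]) = (p z a y)%:R * joint_law z a y.
  case: (boolP (p z a y)) => pzay; rewrite ?mul1r ?mul0r.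
    congr (Pr P _); apply/seteqP; split => w /=; first by case=> [[[]]].
    by case=> -> -> ->.
  rewrite (_ : _ `&` _ = set0) ?/Pr ?measure0//.
  apply/seteqP; split => w //= [[[pw zw] aw] yw]; move: pw.
  by rewrite zw aw yw; apply/negP.
rewrite (Pr_splitb Z)// (Pr_splitb A (mI _ Z true mp)) (Pr_splitb A (mI _ Z false mp)).
rewrite !(Pr_splitb Y (mI _ A _ (mI _ Z _ mp))) !cell.
by rewrite !big_bool /= !addrA.
Qed.

Lemma Pr_joint_lawP (E : set Omega) (p : bool -> bool -> bool -> bool) :
  (forall w, E w <-> p (Z w) (A w) (Y w)) ->
  Pr P E =
  \sum_(z : bool) \sum_(a : bool) \sum_(y : bool) (p z a y)%:R * joint_law z a y.
Proof.
move=> Ep; rewrite -Pr_joint_law; congr (Pr P _); apply/seteqP.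
by split => w /Ep.
Qed.

End finite_joint_law.

(** * The cost-sensitive risk as half of the Lagrangian *)

Section cost_sensitive_risk.
Context d d' (Omega : measurableType d) (T : measurableType d') (R : realType).
Variables (P : probability Omega R) (A Y : {RV P >-> bool}).
Hypothesis p_gt0 : forall a y : bool, 0 < p_AY A Y a y.
Variable Yhat : (T -> R) -> {RV P >-> bool}.

Lemma p_A_sum a : p_A A a = p_AY A Y a true + p_AY A Y a false.
Proof.
rewrite /p_A (Pr_splitb Y); last exact: measurable_eqb.
by [].
Qed.

Lemma p_A_gt0 a : 0 < p_A A a.
Proof. by rewrite p_A_sum addr_gt0. Qed.

Lemma p_AY_joint_law Z a y :
  p_AY A Y a y = joint_law Z A Y true a y + joint_law Z A Y false a y.
Proof.
rewrite /p_AY (Pr_splitb Z); last first.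
  by apply: (@measurableI _ _ [set w | A w = a]); exact: measurable_eqb.
by congr (Pr P _ + Pr P _); apply/seteqP; split => w /= => [[[-> ->] ->]|[-> -> ->]].
Qed.

Lemma fcsc_riskE D t : exists C, forall f,
  fcsc_risk A Y Yhat D t f =
  C + risk Y Yhat f / 2 + t / 2 * Dis A Y Yhat D f.
Proof.
have pA a : p_A A a != 0 by rewrite gt_eqF ?p_A_gt0.
have pAY a y : p_AY A Y a y != 0 by rewrite gt_eqF.
(* The constant comes from the false negatives: their probability is [p_AY a true] minus that of the
   true positives, and [c] collects [t] times the first part. Under [PD] the multiplier weighs only
   false positives, hence 0. *)
pose c (a y : bool) := match D with
  | DD => - y%:R * (2 * a%:R - 1) * p_AY A Y a y * t / (2 * p_A A a)
  | DO => y%:R * (1 - 2 * a%:R) * t / 2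
  | PD => 0 end.
exists (\sum_(a : bool) \sum_(y : bool) c a y) => f.
set Z := Yhat f.
have J0 a y : joint_law Z A Y false a y = p_AY A Y a y - joint_law Z A Y true a y.
  by rewrite (p_AY_joint_law Z) addrC addKr.
have riskE : risk Y Yhat f = \sum_(a : bool) \sum_(y : bool) joint_law Z A Y (~~ y) a y.
  rewrite /risk (@Pr_joint_lawP _ _ _ _ Z A Y _ (fun z a y => y != z)).
    by rewrite !big_bool /=; ring.
  by move=> w; split => /eqP.
have DisE : Dis A Y Yhat D f = match D with
  | DD => (joint_law Z A Y true true true + joint_law Z A Y true true false) / p_A A true
          - (joint_law Z A Y true false true + joint_law Z A Y true false false) / p_A A false
  | DO => joint_law Z A Y true true true / p_AY A Y true true
          - joint_law Z A Y true false true / p_AY A Y false true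
  | PD => joint_law Z A Y true true false / p_AY A Y true false
          - joint_law Z A Y true false false / p_AY A Y false false end.
  rewrite /Dis /Pr_given -/Z.
  have posA a : Pr P ([set w | Z w = true] `&` [set w | A w = a]) =
      joint_law Z A Y true a true + joint_law Z A Y true a false.
    rewrite (@Pr_joint_lawP _ _ _ _ Z A Y _ (fun z a' y => z && (a' == a))).
      by case: a; rewrite !big_bool /=; ring.
    by move=> w /=; split => [[-> ->] /=|/andP[-> /eqP ->]].
  have posAY a y : Pr P ([set w | Z w = true] `&` [set w | A w = a /\ Y w = y]) =
      joint_law Z A Y true a y.
    by congr (Pr P _); apply/seteqP; split => w /= => [[-> [-> ->]]|[-> -> ->]].
  by case: D {c}; rewrite ?posA ?posAY.
have -> : fcsc_risk A Y Yhat D t f = \sum_(a : bool) \sum_(y : bool)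
    fcsc_weight A Y D t a y * joint_law Z A Y (~~ y) a y by [].
rewrite riskE DisE !big_bool /= !J0 /c /fcsc_weight.
by case: D {c DisE riskE} => /=; field; rewrite ?pA ?pAY.
Qed.

End cost_sensitive_risk.

(** * Risk and disparities as integrals against the law of [X] *)

Section attribute_blind.
Context d d' (Omega : measurableType d) (T : measurableType d') (R : realType).
Variables (P : probability Omega R) (X : {RV P >-> T}) (A Y : {RV P >-> bool}).
Hypothesis p_gt0 : forall a y : bool, 0 < p_AY A Y a y.
Variables (etaY etaA : T -> R) (etaYA : bool -> T -> R).
Hypothesis etaYP : is_cond_prob P X [set w | Y w = true] etaY.
Hypothesis etaAP : is_cond_prob P X [set w | A w = true] etaA.
Hypothesis etaYAP : is_cond_prob P (fun w => (A w, X w)) [set w | Y w = true]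
  (fun z : bool * T => etaYA z.1 z.2).
Variable Yhat : (T -> R) -> {RV P >-> bool}.
Hypothesis YhatP : forall f, classifier f -> is_prediction X A Y f (Yhat f).

Local Notation mu := (distribution P X).

Let etaA_of a x := if a then etaA x else 1 - etaA x.
Let etaYA_of y a x := if y then etaYA a x else 1 - etaYA a x.

Let setC_eqb (B : {RV P >-> bool}) :
  ~` [set w | B w = true] = [set w | B w = false].
Proof. by apply/seteqP; split => w /=; case: (B w). Qed.

Lemma is_cond_prob_false (B : {RV P >-> bool}) dZ (U : measurableType dZ)
    (Z : Omega -> U) g : measurable_fun setT Z ->
  is_cond_prob P Z [set w | B w = true] g ->
  is_cond_prob P Z [set w | B w = false] (fun z => 1 - g z).
Proof.
by move=> mZ /(is_cond_prob_setC mZ (measurable_eqb _ _)); rewrite setC_eqb.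
Qed.

Let etaA_ofP a : is_cond_prob P X [set w | A w = a] (etaA_of a).
Proof. by case: a => //; exact: is_cond_prob_false. Qed.

Let etaAY_ofP a y : is_cond_prob P X [set w | A w = a /\ Y w = y]
  (fun x => etaYA_of y a x * etaA_of a x).
Proof.
have -> : [set w | A w = a /\ Y w = y] = [set w | Y w = y] `&` [set w | A w = a].
  by apply/seteqP; split => w /= [].
apply: (is_cond_prob_chain (h := fun z => etaYA_of y z.1 z.2)) => //.
case: y => //; apply: is_cond_prob_false => //.
exact: measurable_fun_pair.
Qed.

(* All three disparities compare two conditional probabilities given events
   that are determined by the pair (A, Y). *)
Lemma weight_decomposition D : exists (V : set bool) (q : bool -> T -> R),
  let E a := [set w | A w = a /\ V (Y w)] in
  [/\ forall a, is_cond_prob P X (E a) (q a),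
      forall a, 0 < Pr P (E a),
      weight A Y etaA etaYA D =
        (fun x => q true x / Pr P (E true) - q false x / Pr P (E false)) &
      forall f, let pos := [set w | Yhat f w = true] in
        Dis A Y Yhat D f = Pr_given P pos (E true) - Pr_given P pos (E false)].
Proof.
have AT a : [set w | A w = a /\ [set: bool] (Y w)] = [set w | A w = a].
  by apply/seteqP; split => w //= [].
case: D.
- exists setT, etaA_of => /=; rewrite !AT; split => // a; rewrite AT //.
  exact: p_A_gt0.
- by exists [set true], (fun a x => etaYA_of true a x * etaA_of a x);
    split => [a|a||f //]; [exact: etaAY_ofP|exact: p_gt0|].
- by exists [set false], (fun a x => etaYA_of false a x * etaA_of a x);
    split => [a|a||f //]; [exact: etaAY_ofP|exact: p_gt0|].
Qed.

Let integrable01 (g : T -> R) : measurable_fun setT g ->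
  (forall x, 0 <= g x <= 1) -> mu.-integrable setT (EFin \o g).
Proof.
move=> mg g01; apply: (@integrable_of_bound _ _ _ mu 1) => // x.
by have /andP[? ?] := g01 x; rewrite ger0_norm.
Qed.

Let integrable01M (f g : T -> R) : classifier f -> measurable_fun setT g ->
  (forall x, 0 <= g x <= 1) -> mu.-integrable setT (EFin \o (fun x => f x * g x)).
Proof.
move=> [mf f01] mg g01; apply: integrable01; first exact: measurable_funM.
by move=> x; have := f01 x; have := g01 x; nra.
Qed.

(** Each [q a] integrates to the probability of its event, so both normalised terms have mean one
    and [w] has mean zero. [prediction_Pr] on the two events gives the linear form of the
    disparity. *)
Lemma weight_properties D : let w := weight A Y etaA etaYA D in
  [/\ measurable_fun setT w, exists M, forall x, `|w x| <= M,
      \int[mu]_x w x = 0 &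
      forall f, classifier f -> Dis A Y Yhat D f = \int[mu]_x (f x * w x)].
Proof.
have [V [q /= [qP E_gt0 -> DisE]]] := weight_decomposition D.
set p1 := Pr P _; set p0 := Pr P [set w | A w = false /\ _].
have p1_gt0 : 0 < p1 by exact: E_gt0.
have p0_gt0 : 0 < p0 by exact: E_gt0.
have mq a : measurable_fun setT (q a) by case: (qP a).
have q01 a x : 0 <= q a x <= 1 by case: (qP a).
split.
- by apply: measurable_funB; apply: measurable_funM.
- exists (p1^-1 + p0^-1) => x; apply: le_trans (ler_normB _ _) _.
  have qp a p : 0 < p -> `|q a x / p| <= p^-1.
    move=> p_gt0'; have /andP[? ?] := q01 a x.
    by rewrite normrM normfV (gtr0_norm p_gt0') ler_piMl ?invr_ge0 ?(ltW p_gt0')// ger0_norm.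
  by apply: lerD; exact: qp.
- have iq a p : mu.-integrable setT (EFin \o (fun x => q a x / p)).
    exact: (integrableZr measurableT _ (integrable01 (mq a) (q01 a))).
  rewrite RintegralB// !RintegralZr//; try exact: integrable01.
  by rewrite -!(is_cond_prob_Pr (qP _)) !divff ?gt_eqF// subrr.
- move=> f f_cl; rewrite DisE /Pr_given.
  have posE a : Pr P ([set w | Yhat f w = true] `&` [set w | A w = a /\ V (Y w)]) =
      \int[mu]_x (f x * q a x).
    exact: (prediction_Pr (U := [set a]) (V := V) f_cl (YhatP f_cl) erefl (qP a)).
  rewrite !posE -/p1 -/p0.
  under [RHS]eq_Rintegral do rewrite mulrBr !mulrA.
  have ifq a p : mu.-integrable setT (EFin \o (fun x => f x * q a x / p)).
    exact: (integrableZr measurableT _ (integrable01M f_cl (mq a) (q01 a))).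
  by rewrite RintegralB// !RintegralZr//; exact: integrable01M.
Qed.

Lemma riskE f : classifier f ->
  risk Y Yhat f = Pr P [set w | Y w = true] + \int[mu]_x (f x * (1 - 2 * etaY x)).
Proof.
move=> f_cl; have [meta eta01 _] := etaYP.
have etaNP := is_cond_prob_false (measurable_funP X) etaYP.
have [metaN etaN01 _] := etaNP.
have pos y g : is_cond_prob P X [set w | Y w = y] g ->
    Pr P ([set w | Yhat f w = true] `&` [set w | Y w = y]) = \int[mu]_x (f x * g x).
  apply: (prediction_Pr (U := setT) (V := [set y]) f_cl (YhatP f_cl)).
  by apply/seteqP; split => w //= [].
(* Errors are the positives that are not predicted plus the negatives predicted positive; this
   leaves only events with prediction 1, which are integrals of [f]. *)
have -> : risk Y Yhat f = Pr P [set w | Y w = true]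
    - Pr P ([set w | Yhat f w = true] `&` [set w | Y w = true])
    + Pr P ([set w | Yhat f w = true] `&` [set w | Y w = false]).
  rewrite /risk; set Z := Yhat f.
  rewrite (@Pr_joint_lawP _ _ _ P Z A Y [set w | Y w <> Z w]
    (fun z a y => y != z)); last first.
    by move=> w; split => /eqP.
  rewrite (@Pr_joint_lawP _ _ _ P Z A Y [set w | Y w = true] (fun z a y => y)); last by [].
  rewrite (@Pr_joint_lawP _ _ _ P Z A Y
    ([set w | Z w = true] `&` [set w | Y w = true]) (fun z a y => z && y)); last first.
    by move=> w /=; split => [[-> ->]|/andP[-> ->]].
  rewrite (@Pr_joint_lawP _ _ _ P Z A Y
    ([set w | Z w = true] `&` [set w | Y w = false]) (fun z a y => z && ~~ y)); last first.
    by move=> w /=; split => [[-> ->]|/andP[-> /negbTE ->]].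
  by rewrite !big_bool /=; ring.
rewrite (pos _ _ etaYP) (pos _ _ etaNP) -addrA; congr (_ + _).
rewrite addrC -RintegralB//; try exact: integrable01M.
by apply: eq_Rintegral => x _; ring.
Qed.

End attribute_blind.

(** * From Lagrangian optimality to constrained optimality *)

Theorem theoremB7 (d d' : measure_display) (Omega : measurableType d)
    (T : measurableType d') (R : realType) (P : probability Omega R)
    (X : {RV P >-> T}) (A Y : {RV P >-> bool})
    (p_gt0 : forall a y : bool, 0 < p_AY A Y a y)
    (etaY etaA : T -> R) (etaYA : bool -> T -> R)
    (etaYP : is_cond_prob P X [set w | Y w = true] etaY)
    (etaAP : is_cond_prob P X [set w | A w = true] etaA)
    (etaYAP : is_cond_prob P (fun w => (A w, X w)) [set w | Y w = true]
                (fun z : bool * T => etaYA z.1 z.2))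
    (Yhat : (T -> R) -> {RV P >-> bool})
    (YhatP : forall f, classifier f -> is_prediction X A Y f (Yhat f))
    (D : disparity)
    (pdf_etaY : has_pdf P (fun w => etaY (X w)))
    (pdf_weight : has_pdf P (fun w => weight A Y etaA etaYA D (X w)))
    (boundary : forall t : R,
       distribution P X
         [set x | etaY x = 1 / 2 + t / 2 * weight A Y etaA etaYA D x] = 0%E)
    (delta : R) (delta_ge0 : 0 <= delta)
    (f : T -> R)
    (f_min : argmin (@classifier d' T R)
               (fcsc_risk A Y Yhat D (t_X X A Y etaY etaA etaYA D delta)) f) :
  fair_bayes_optimal A Y Yhat D delta f.
Proof.
case: (f_min) => f_cl f_opt.
have [meta eta01 _] := etaYP.
have [mw [M wM] w_int0 DisE] :=
  weight_properties p_gt0 etaAP etaYAP YhatP D.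
set w := weight A Y etaA etaYA D in mw wM w_int0 DisE boundary.
set t := t_X X A Y etaY etaA etaYA D delta in f_opt f_min.
pose mu := distribution P X.
(* A law with a density gives no mass to a point. *)
have w_neq0 : mu [set x | w x = 0] = 0%E.
  have [g [mg _ gP]] := pdf_weight.
  rewrite [LHS](gP [set 0] (measurable_set1 0)).
  exact: integral_set1.
(* The argmin is nonempty, so the default value in [t_X] is not a concern and [t] is a genuine
   minimiser. *)
have t_argmin : argmin [set s | `|level_integral mu etaY w s| <= delta]
    (fun s => `|s|) t.
  apply: xgetPex.
  exact: (level_integral_argmin_neq0 meta mw wM boundary w_int0 w_neq0 eta01 delta_ge0).
pose L g : R := risk Y Yhat g + t * Dis A Y Yhat D g.
have LE g : classifier g ->
    L g = Pr P [set w | Y w = true] + \int[mu]_x (g x * (1 - 2 * etaY x + t * w x)).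
  move=> g_cl; have [mg g01] := g_cl.
  rewrite /L (riskE etaYP YhatP g_cl) DisE// -addrA; congr (_ + _).
  have i1 : mu.-integrable setT (EFin \o (fun x => g x * (1 - 2 * etaY x))).
    apply: (@integrable_of_bound _ _ _ mu 1).
      by apply: measurable_funM => //; apply: measurable_funB => //; exact: measurable_funM.
    move=> x; rewrite normrM mulr_ile1//.
      by have /andP[? ?] := g01 x; rewrite ger0_norm.
    by have := eta01 x; rewrite ler_norml; lra.
  have i2 : mu.-integrable setT (EFin \o (fun x => g x * w x)).
    apply: (@integrable_of_bound _ _ _ mu M); first exact: measurable_funM.
    move=> x; rewrite normrM; apply: le_trans (wM x).
    by apply: ler_piMl => //; have /andP[? ?] := g01 x; rewrite ger0_norm.
  rewrite -RintegralZl// -RintegralD//; last exact: (integrableZl measurableT t i2).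
  by apply: eq_Rintegral => x _; ring.
(* The cost-sensitive risk equals a constant plus half of [L]. *)
have L_min g : classifier g -> L f <= L g.
  move=> g_cl; have [C fcscE] := fcsc_riskE p_gt0 Yhat D t.
  by have := f_opt g g_cl; rewrite !fcscE /L; lra.
have f_level : Dis A Y Yhat D f = level_integral mu etaY w t.
  rewrite DisE//; apply: (argmin_lagrangian_integral meta mw wM eta01 (boundary t)).
  by split => // g g_cl; have := L_min g g_cl; rewrite !LE// lerD2l.
split.
  by split => //=; rewrite f_level; case: t_argmin.
move=> g [/= g_cl g_fair].
(* Slackness bounds [t] times the disparity of [g] by [t] times that of [f], so the multiplier terms
   cancel from [L f <= L g] in the right direction. *)
have := argmin_threshold_slackness meta mw wM boundary delta_ge0 t_argmin g_fair.
by have := L_min g g_cl; rewrite /L f_level; lra.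
Qed.
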